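(* Let $N\ge 2$, $a\in\mathbb{R}$, $\alpha\in(0,1]$, and let $P\in\mathbb{R}^{N\times N}$ be a symmetric, doubly stochastic matrix with nonnegative entries whose eigenvalues satisfy $-1<\lambda_N(P)\le\dots\le\lambda_2(P)<\lambda_1(P)=1$. Let $x_{t+1}=ax_t+r_t$ and $y_{i,t}=x_t+w_{i,t}$ ($i=1,\dots,N$), where $x_0$ is an independent finite random variable, the innovations $r_t$ are zero mean, independent over time with variance $\sigma_r^2$, the observation noises $w_{i,t}$ are zero mean with variance $\sigma_w^2$, independent over time and across agents, and uncorrelated with the innovations. Define the estimates $$\hat{x}_{i,t+1}=a\Big(\sum_{j=1}^N p_{ij}\hat{x}_{j,t}+\alpha(y_{i,t}-\hat{x}_{i,t})\Big),\qquad \tilde{x}_{i,t+1}=a\Big(\sum_{j=1}^N p_{ij}\tilde{x}_{j,t}+\alpha\Big(\sum_{j=1}^N p_{ij}y_{j,t}-\tilde{x}_{i,t}\Big)\Big),$$ error vectors $\hat{\xi}_t=(\hat{x}_{i,t}-x_t)_{i=1}^N$, $\tilde{\xi}_t=(\tilde{x}_{i,t}-x_t)_{i=1}^N$, and $Q=a(P-\alpha I_N)$. Suppose the spectral radius satisfies $\rho(Q)<1$. Let $\hat{\Sigma}=\lim_{t\to\infty}\mathbb{E}[\hat{\xi}_t\hat{\xi}_t^{\mathsf T}]$, $\tilde{\Sigma}=\lim_{t\to\infty}\mathbb{E}[\tilde{\xi}_t\tilde{\xi}_t^{\mathsf T}]$, $\hat{\mathrm{MSD}}(P,\alpha)=\frac1N\mathrm{Tr}(\hat{\Sigma})$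 and $\tilde{\mathrm{MSD}}(P,\alpha)=\frac1N\mathrm{Tr}(\tilde{\Sigma})$. Then $$\hat{\mathrm{MSD}}(P,\alpha)=R_{MSD}(\alpha)+\frac1N\sum_{i=1}^N\frac{a^2\alpha^2\sigma_w^2}{1-a^2(\lambda_i(P)-\alpha)^2},\qquad \tilde{\mathrm{MSD}}(P,\alpha)=R_{MSD}(\alpha)+\frac1N\sum_{i=1}^N\frac{a^2\alpha^2\sigma_w^2\lambda_i^2(P)}{1-a^2(\lambda_i(P)-\alpha)^2},$$ where $R_{MSD}(\alpha)=\dfrac{\sigma_r^2}{1-a^2(1-\alpha)^2}$.
   Context: $\lambda_i(P)$ denote the eigenvalues of $P$; MSD stands for steady-state mean square deviation per agent. *)

(* Defs.v *)
From HB Require Import structures.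
From mathcomp Require Import all_boot all_order all_algebra.
From mathcomp Require Import all_classical all_reals all_analysis.
From mathcomp Require Import complex.

Set Implicit Arguments.
Unset Strict Implicit.
Unset Printing Implicit Defensive.

Import Order.TTheory GRing.Theory Num.Theory.
Import numFieldNormedType.Exports.

Local Open Scope classical_set_scope.
Local Open Scope ring_scope.

Definition spectral_radius_lt1 (R : rcfType) (n : nat) (Q : 'M[R]_n) : Prop :=
  forall z : R[i], root (map_poly (fun x : R => (x%:C)%C) (char_poly Q)) z ->
    `|z| < 1.

Definition indep2 d (T : measurableType d) (R : realType) (P : probability T R)
  (X Y : T -> R) : Prop :=
  forall A B : set R, measurable A -> measurable B ->
    P (X @^-1` A `&` Y @^-1` B) = (P (X @^-1` A) * P (Y @^-1` B))%E.

Definition mutually_indep d (T : measurableType d) (R : realType)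
  (P : probability T R) (I : eqType) (X : I -> T -> R) : Prop :=
  forall (s : seq I) (B : I -> set R), uniq s -> (forall i, measurable (B i)) ->
    P (\big[setI/setT]_(i <- s) (X i @^-1` B i)) =
    (\prod_(i <- s) P (X i @^-1` B i))%E.

Section model.
Variables (R : realType) (T : Type) (N : nat).
Variables (a alpha : R) (Pm : 'M[R]_N).
Variables (x0 : T -> R) (r : nat -> T -> R) (w : 'I_N -> nat -> T -> R).

Fixpoint state (t : nat) (om : T) : R :=
  match t with
  | 0 => x0 om
  | t'.+1 => a * state t' om + r t' om
  end.

Definition obs (i : 'I_N) (t : nat) (om : T) : R := state t om + w i t om.

Fixpoint est_hat (xh0 : 'I_N -> R) (t : nat) (om : T) : 'I_N -> R :=
  match t with
  | 0 => xh0
  | t'.+1 => fun i =>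
      a * (\sum_(j < N) Pm i j * est_hat xh0 t' om j
           + alpha * (obs i t' om - est_hat xh0 t' om i))
  end.

Fixpoint est_tilde (xt0 : 'I_N -> R) (t : nat) (om : T) : 'I_N -> R :=
  match t with
  | 0 => xt0
  | t'.+1 => fun i =>
      a * (\sum_(j < N) Pm i j * est_tilde xt0 t' om j
           + alpha * (\sum_(j < N) Pm i j * obs j t' om - est_tilde xt0 t' om i))
  end.

Definition err_hat xh0 (t : nat) (i : 'I_N) (om : T) : R :=
  est_hat xh0 t om i - state t om.
Definition err_tilde xt0 (t : nat) (i : 'I_N) (om : T) : R :=
  est_tilde xt0 t om i - state t om.
End model.

(* Main.v *)
Require Import Defs.
From HB Require Import structures.
From mathcomp Require Import all_boot all_order all_algebra.
From mathcomp Require Import all_classical all_reals all_analysis.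
From mathcomp Require Import complex.
From mathcomp Require Import measurable_realfun ring.
Import Order.TTheory GRing.Theory Num.Theory.
Import numFieldNormedType.Exports.

(** The errors satisfy [xi_(t+1) = Q xi_t + B w_t - r_t 1], with
    [B = a alpha I] for the first scheme and [B = a alpha P] for the second,
    because the rows of [P] sum to one.  The current noises are uncorrelated
    with the past errors, so the second moments obey
    [M_(t+1) = Q M_t Q^T + sigma_w^2 B B^T + sigma_r^2 J], with [J] the all-ones
    matrix.  A symmetric real matrix is diagonalizable, say [S P = D S]; in the
    coordinates [S M_t S^-1] the recursion splits into scalar affine recursions,
    one per entry, whose ratios are products of two eigenvalues of [Q].
    As [Q^T = Q], any diagonalizing [S] will do, orthogonal or not.  Finally
    [P J = J] gives [D (S J S^-1) = S J S^-1], so the innovations only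
    contribute through the eigenvalue 1. *)

Set Implicit Arguments.
Unset Strict Implicit.
Unset Printing Implicit Defensive.

Local Open Scope classical_set_scope.
Local Open Scope ring_scope.

(** * Symmetric matrices *)

(** Each diagonal entry of [A *m A^T] is the sum of the squares of a row of [A]. *)
Lemma mulmx_tr_eq0 (R : realFieldType) (m n : nat) (A : 'M[R]_(m, n)) :
  A *m A^T = 0 -> A = 0.
Proof.
move=> /matrixP A0; apply/matrixP => i j; rewrite mxE; apply/eqP.
have := A0 i i; rewrite !mxE => /eqP.
rewrite psumr_eq0; last by move=> k _; rewrite mxE -expr2 sqr_ge0.
by move=> /allP/(_ j (mem_index_enum _)); rewrite mxE mulf_eq0 orbb.
Qed.

(** Enlarge the exponent to a power of two, then halve it repeatedly: each [A ^+ (2 ^ k)] is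
    symmetric, so its square has the form [X *m X^T]. *)
Lemma sym_nilpotent_eq0 (R : realFieldType) (n : nat) (A : 'M[R]_n.+1)
  (k : nat) :
  A^T = A -> A ^+ k = 0 -> A = 0.
Proof.
move=> As Ak0; have : A ^+ (2 ^ k) = 0.
  by rewrite -(subnK (ltnW (ltn_expl k (ltnSn 1)))) exprD Ak0 mulr0.
elim: k {Ak0} => [|k IHk]; first by rewrite expr1.
rewrite expnSr exprM expr2 => Ak0; apply/IHk/mulmx_tr_eq0.
have trX m : (A ^+ m)^T = A ^+ m.
  elim: m => [|m IHm]; first by rewrite expr0 trmx1.
  by rewrite [in LHS]exprS -[_ * _]/(_ *m _) trmx_mul IHm As [RHS]exprSr.
by rewrite trX.
Qed.

Lemma trmx_horner_mx (R : comNzRingType) (n : nat) (A : 'M[R]_n.+1)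
  (p : {poly R}) :
  (horner_mx A p)^T = horner_mx A^T p.
Proof.
elim/poly_ind: p => [|p c IHp]; first by rewrite !rmorph0 trmx0.
rewrite !rmorphD !rmorphM /= linearD /= !horner_mx_C !horner_mx_X tr_scalar_mx.
rewrite trmx_mul IHp; congr (_ + _).
exact: (comm_mx_horner _ (comm_mx_refl _)).
Qed.

(** It suffices that [A] be annihilated by a product of distinct linear factors, here over
    [undup rs]. Evaluated at [A], that product is symmetric and nilpotent, hence zero. *)
Lemma sym_diagonalizable (R : realFieldType) (n : nat) (A : 'M[R]_n.+1)
  (rs : seq R) : A^T = A -> char_poly A = \prod_(x <- rs) ('X - x%:P) ->
  diagonalizable A.
Proof.
move=> As Ars; apply/diagonalizableP; exists (undup rs); first exact: undup_uniq.
(* [char_poly A] divides a power of [q], so [horner_mx A q] is nilpotent. *)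
set q := \prod_(x <- _) _; apply: mxminpoly_min.
apply: (@sym_nilpotent_eq0 _ _ _ (size rs)); first by rewrite trmx_horner_mx As.
rewrite -rmorphXn /=; apply/eqP; rewrite -dvd_mxminpoly.
apply: (dvdp_trans (mxminpoly_dvd_char _)); rewrite Ars.
(* Every factor ['X - x%:P] with [x] in [rs] divides [q]; letting [s] vary while [q] stays fixed
   makes the induction possible. *)
have /(_ rs) : forall s, {subset s <= rs} ->
    \prod_(x <- s) ('X - x%:P) %| q ^+ size s.
  elim=> [|x s IHs] xs; first by rewrite big_nil expr0 dvdpp.
  rewrite big_cons exprS dvdp_mul ?IHs//; last first.
    by move=> y ys; apply: xs; rewrite inE ys orbT.
  rewrite dvdp_XsubCl root_prod_XsubC mem_undup; apply: xs; exact: mem_head.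
exact.
Qed.

(** [S] also intertwines the characteristic matrices; in their determinants the unit constant
    [\det S] cancels. *)
Lemma char_poly_simmx (R : fieldType) (n : nat) (S A B : 'M[R]_n) :
  S \in unitmx -> S *m A = B *m S -> char_poly A = char_poly B.
Proof.
move=> Su SA; rewrite /char_poly.
have Su' : map_mx polyC S \in unitmx.
  by rewrite unitmxE det_map_mx rmorph_unit// -unitmxE.
have E : map_mx polyC S *m char_poly_mx A = char_poly_mx B *m map_mx polyC S.
  by rewrite /char_poly_mx mulmxBr mulmxBl -!map_mxM SA scalar_mxC.
move/(congr1 determinant): E; rewrite !det_mulmx mulrC.
by apply: mulIr; rewrite -unitmxE.
Qed.

(** Diagonalization may list the eigenvalues in another order than [lam]; unique factorization of
    the characteristic polynomial supplies the permutation. *)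
Lemma sym_spectral (R : realFieldType) (n : nat) (A : 'M[R]_n)
  (lam : 'I_n -> R) :
  A^T = A -> char_poly A = \prod_(i < n) ('X - (lam i)%:P) ->
  exists S : 'M[R]_n, exists d : 'rV[R]_n, [/\ S \in unitmx,
    S *m A = diag_mx d *m S &
    perm_eq [seq d 0 i | i <- enum 'I_n] [seq lam i | i <- enum 'I_n]].
Proof.
case: n A lam => [|n] A lam As Al.
  exists 1%:M, 0; split; first exact: unitmx1.
    by apply/matrixP => -[].
  by rewrite (_ : enum 'I_0 = [::])//; apply: size0nil; rewrite size_enum_ord.
have prodE (f : 'I_n.+1 -> R) :
    \prod_(x <- [seq f i | i <- enum 'I_n.+1]) ('X - x%:P) =
    \prod_i ('X - (f i)%:P).
  by rewrite big_map big_enum.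
have /(sym_diagonalizable As) := etrans Al (esym (prodE lam)).
move=> [S Su /similar_diagPex[d /(similarP Su) SA]].
exists S, d; split=> //.
apply/prod_XsubC_eq.
rewrite !prodE -Al (char_poly_simmx Su SA).
rewrite char_poly_trig ?diag_mx_is_trig//.
by apply: eq_bigr => i _; rewrite mxE eqxx mulr1n.
Qed.

(** * Linear recursions *)

(** The limit [l] is the fixed point of the recursion, and each step multiplies the deviation from
    it by [c]. *)
Lemma cvg_affine_recurrence (R : realType) (c v : R) (u : R ^nat) :
  `|c| < 1 -> (forall t, u t.+1 = c * u t + v) ->
  u t @[t --> \oo] --> v / (1 - c).
Proof.
move=> c1 uE; set l := v / (1 - c).
have c1N0 : 1 - c != 0.
  by rewrite subr_eq0 eq_sym lt_eqF// (le_lt_trans (ler_norm _)).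
have lE : l = c * l + v by apply/eqP; rewrite -subr_eq0 /l; apply/eqP; field.
have E t : u t = c ^+ t * (u 0 - l) + l.
  elim: t => [|t IHt]; first by rewrite expr0 mul1r subrK.
  by rewrite uE IHt exprS mulrDr mulrA -addrA -lE.
rewrite (_ : u = fun t => c ^+ t * (u 0 - l) + l); last exact/funext.
rewrite -[X in _ --> X]add0r -(mul0r (u 0 - l)).
apply: cvgD; last exact: cvg_cst.
apply: cvgM; last exact: cvg_cst.
exact: cvg_expr.
Qed.

Lemma cvg_sum (R : realType) (I : Type) (r : seq I) (f : I -> R ^nat)
  (l : I -> R) :
  (forall i, f i t @[t --> \oo] --> l i) ->
  \sum_(i <- r) f i t @[t --> \oo] --> \sum_(i <- r) l i.
Proof.
by move=> fl; apply: (cvg_big (op := +%R)) => // x; exact: add_continuous.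
Qed.

Lemma cvg_lyapunov_recurrence (R : realType) (n : nat) (Q V S : 'M[R]_n)
  (q : 'rV[R]_n) (M : nat -> 'M[R]_n) :
  S \in unitmx -> S *m Q = diag_mx q *m S -> (forall i, `|q 0 i| < 1) ->
  (forall t, M t.+1 = Q *m M t *m Q + V) ->
  exists L : 'M[R]_n,
    (forall i j, M t i j @[t --> \oo] --> L i j) /\
    \tr L = \sum_i (S *m V *m invmx S) i i / (1 - q 0 i ^+ 2).
Proof.
move=> Su SQ q1 ME.
(* [K] collects the fixed points of the scalar recursions, one per entry; its diagonal gives the
   trace formula. *)
pose K : 'M[R]_n := \matrix_(i, j)
  ((S *m V *m invmx S) i j / (1 - q 0 i * q 0 j)).
have QE : Q *m invmx S = invmx S *m diag_mx q.
  by rewrite -[LHS](mulKmx Su) [S *m _]mulmxA SQ mulmxK.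
pose K_ t := S *m M t *m invmx S.
have KE t : K_ t.+1 = diag_mx q *m K_ t *m diag_mx q + S *m V *m invmx S.
  rewrite /K_ ME mulmxDr mulmxDl; congr (_ + _).
  by rewrite !mulmxA SQ -!mulmxA QE.
have K_cvg i j : K_ t i j @[t --> \oo] --> K i j.
  rewrite [K i j]mxE; apply: cvg_affine_recurrence.
    by rewrite normrM mulr_ilt1.
  move=> t; rewrite KE mxE; congr (_ + _).
  rewrite mul_mx_diag mxE mul_diag_mx mxE; ring.
have MK t : M t = invmx S *m K_ t *m S by rewrite /K_ -mulmxA mulmxKV// mulKmx.
exists (invmx S *m K *m S); split=> [i j|]; last first.
  rewrite mxtrace_mulC mulmxA mulmxV// mul1mx; apply: eq_bigr => i _.
  by rewrite mxE expr2.
rewrite (_ : (fun t => M t i j) = fun t =>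
    \sum_k (\sum_l invmx S i l * K_ t l k) * S k j); last first.
  apply/funext => t; rewrite MK mxE; apply: eq_bigr => k _; by rewrite mxE.
rewrite [X in _ --> X]mxE; under [X in _ --> X]eq_bigr do rewrite mxE.
apply: cvg_sum => k; apply: cvgM; last exact: cvg_cst.
by apply: cvg_sum => l; apply: cvgM => //; exact: cvg_cst.
Qed.

(** * Second moments *)

(** Independence makes the law of the pair agree with the product of the laws on rectangles, hence
    everywhere; Fubini's theorem then splits the integral of [z.1 * z.2]. *)
Lemma indep2_expectationM d (T : measurableType d) (R : realType)
    (Pr : probability T R) (X Y : T -> R) :
  X \in Lfun Pr 1 -> Y \in Lfun Pr 1 -> X \* Y \in Lfun Pr 1 ->
  indep2 Pr X Y -> ('E_Pr[X \* Y] = 'E_Pr[X] * 'E_Pr[Y])%E.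
Proof.
move=> X1 Y1 XY1 XY.
have mX : measurable_fun setT X by have := sub_Lfun_mfun X1; rewrite inE.
have mY : measurable_fun setT Y by have := sub_Lfun_mfun Y1; rewrite inE.
pose X' : {RV Pr >-> R} := mfun_Sub (sub_Lfun_mfun X1).
pose Y' : {RV Pr >-> R} := mfun_Sub (sub_Lfun_mfun Y1).
have mZ : measurable_fun setT (fun t => (X t, Y t)).
  exact: measurable_fun_pair.
pose Z' : {RV Pr >-> (R * R)%type} := mfun_Sub (mem_set mZ).
pose mu := distribution Pr X'; pose nu := distribution Pr Y'.
pose f := EFin \o (fun z : R * R => z.1 * z.2).
have mf : measurable_fun [set: R * R] f.
  by apply/measurable_EFinP; apply: measurable_funM;
    [exact: measurable_fst|exact: measurable_snd].
have muE A : measurable A -> (mu \x nu)%E A = distribution Pr Z' A.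
  move=> mA; apply: product_measure_unique; last exact: mA.
  by move=> B C mB mC; exact: XY.
have iX : Pr.-integrable setT (EFin \o X) by exact/Lfun1_integrable.
have iY : Pr.-integrable setT (EFin \o Y) by exact/Lfun1_integrable.
have iXY : Pr.-integrable setT (f \o Z') by have /Lfun1_integrable := XY1.
have iZ : (distribution Pr Z').-integrable setT f.
  exact: integrable_pushforward.
(* Fubini's theorem asks for integrability under the product law; it is carried over from the law of
   the pair. *)
have if_ : (mu \x nu)%E.-integrable setT f.
  apply/integrableP; split=> //.
  rewrite (eq_measure_integral (distribution Pr Z')); last first.
    by move=> A mA _; exact: muE.
  by have /integrableP[] := iZ.
rewrite unlock.
transitivity (\int[Pr]_w (f \o Z') w)%E; first by [].
rewrite -integral_distribution//.
rewrite (eq_measure_integral (mu \x nu)%E); last first.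
  by move=> A mA _; exact/esym/muE.
rewrite -integral12_prod_meas1// /fubini_F.
have idE (W : {RV Pr >-> R}) : Pr.-integrable setT (EFin \o W) ->
    (distribution Pr W).-integrable setT EFin /\
    (\int[distribution Pr W]_x x%:E = \int[Pr]_w (W w)%:E)%E.
  move=> iW; split; first exact: integrable_pushforward.
  by rewrite integral_distribution.
have [iX' EX] := idE X' iX; have [iY' EY] := idE Y' iY.
(* The mean of [Y] is written as a real constant so that it can leave the outer integral. *)
have -> : (\int[Pr]_w (Y w)%:E = (fine (\int[Pr]_w (Y w)%:E))%:E)%E.
  by rewrite fineK// integrable_fin_num.
rewrite -[X in (X * _)%E]EX -integralZr//.
apply: eq_integral => x _.
transitivity (\int[nu]_y (x%:E * y%:E))%E; first by [].
rewrite integralZl//; congr (_ * _)%E.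
by rewrite -[LHS]/(\int[distribution Pr Y']_y y%:E)%E EY fineK// integrable_fin_num.
Qed.

Section second_moments.
Context d (T : measurableType d) (R : realType) (Pr : probability T R).
Implicit Types X Y Z : T -> R.
Local Notation L2 := (Lfun Pr 2%:E).

Lemma Lfun2_mulr X Y : X \in L2 -> Y \in L2 -> (X * Y)%R \in Lfun Pr 1.
Proof. by move=> X2 Y2; exact: Lfun2_mul_Lfun1. Qed.

Lemma Lfun2D X Y : X \in L2 -> Y \in L2 -> (X + Y)%R \in L2.
Proof.
have p1 : (1 <= 2%:E :> \bar R)%E by rewrite lee1n.
exact: (Lfun_addr_closed Pr p1).2.
Qed.

Lemma Lfun2Z c X : X \in L2 -> (fun om => c * X om)%R \in L2.
Proof.
move=> X2; rewrite (_ : (fun _ => _) = c \o* X); last first.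
  by apply/funext => x /=; rewrite mulrC.
by apply: Lfun_scale => //; rewrite ler1n.
Qed.

Lemma Lfun2N X : X \in L2 -> (- X)%R \in L2.
Proof.
move=> /(Lfun2Z (-1)); rewrite (_ : (fun _ => _) = - X)//.
by apply/funext => x; rewrite mulN1r.
Qed.

Lemma Lfun2_cst c : cst c \in L2.
Proof. exact: Lfun_cst. Qed.

Lemma Lfun2_Lfun1 X : X \in L2 -> X \in Lfun Pr 1.
Proof. by apply: Lfun_subset12; rewrite fin_num_measure. Qed.

(** A matrix applied to a row index serves as coefficients: [lincomb (Q i) X] is entry [i] of the
    product of [Q] with the random vector [X]. *)
Definition lincomb n (c : 'I_n -> R) (X : 'I_n -> T -> R) : T -> R :=
  fun om => \sum_i c i * X i om.

(** Stated for an arbitrary list of indices to allow induction. *)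
Lemma Lfun2_lincomb_seq n (c : 'I_n -> R) (X : 'I_n -> T -> R) (s : seq 'I_n) :
  (forall i, X i \in L2) -> (fun om => \sum_(i <- s) c i * X i om) \in L2.
Proof.
move=> X2; elim: s => [|i s IHs].
  rewrite (_ : (fun _ => _) = cst 0) ?Lfun2_cst//.
  by apply/funext => x; rewrite big_nil.
rewrite (_ : (fun _ => _) = (fun om => c i * X i om) +
    (fun om => \sum_(i <- s) c i * X i om))%R; last first.
  by apply/funext => x; rewrite big_cons.
by rewrite Lfun2D// Lfun2Z.
Qed.

Lemma Lfun2_lincomb n (c : 'I_n -> R) (X : 'I_n -> T -> R) :
  (forall i, X i \in L2) -> lincomb c X \in L2.
Proof. exact: Lfun2_lincomb_seq. Qed.

(** The inner product of square-integrable variables; [fine] makes it real, and [dotE] shows that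
    nothing is lost on such variables. *)
Definition dot X Y : R := fine 'E_Pr[X * Y].

Lemma dotE X Y : X \in L2 -> Y \in L2 -> ('E_Pr[X * Y] = (dot X Y)%:E)%E.
Proof. by move=> X2 Y2; rewrite /dot fineK// expectation_fin_num ?Lfun2_mulr. Qed.

Lemma dotC X Y : dot X Y = dot Y X.
Proof. by rewrite /dot mulrC. Qed.

Lemma dotDl X Y Z : X \in L2 -> Y \in L2 -> Z \in L2 ->
  dot (X + Y) Z = dot X Z + dot Y Z.
Proof.
move=> X2 Y2 Z2; apply: EFin_inj.
rewrite -dotE ?Lfun2D// mulrDl expectationD ?Lfun2_mulr// EFinD.
by rewrite -!dotE.
Qed.

Lemma dotZl c X Y : X \in L2 -> Y \in L2 ->
  dot (fun om => c * X om) Y = c * dot X Y.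
Proof.
move=> X2 Y2; apply: EFin_inj; rewrite -dotE ?Lfun2Z// EFinM -dotE//.
rewrite -expectationZl ?Lfun2_mulr//; congr expectation.
apply/funext => x; rewrite -[LHS]/(c * X x * Y x) -[RHS]/(X x * Y x * c); ring.
Qed.

Lemma dotNl X Y : X \in L2 -> Y \in L2 -> dot (- X) Y = - dot X Y.
Proof.
move=> X2 Y2; rewrite -[RHS]mulN1r -dotZl//; congr dot.
by apply/funext => x; rewrite mulN1r.
Qed.

Lemma dot0l X : dot (cst 0) X = 0.
Proof.
rewrite /dot (_ : cst 0 * X = cst 0) ?expectation_cst//.
by apply/funext => x; exact: mul0r.
Qed.

Lemma dot_lincombl n (c : 'I_n -> R) (X : 'I_n -> T -> R) Y :
  (forall i, X i \in L2) -> Y \in L2 ->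
  dot (lincomb c X) Y = \sum_i c i * dot (X i) Y.
Proof.
move=> X2 Y2; rewrite /lincomb; elim: (index_enum _) => [|i s IHs].
  rewrite big_nil -[RHS](dot0l Y); congr dot.
  by apply/funext => x; rewrite big_nil.
rewrite big_cons -IHs -dotZl// -dotDl ?Lfun2Z ?Lfun2_lincomb_seq//; congr dot.
by apply/funext => x; rewrite big_cons.
Qed.

Lemma dot_cstl c X : X \in L2 -> dot (cst c) X = c * fine 'E_Pr[X].
Proof.
move=> X2; rewrite /dot (_ : cst c * X = c \o* X)%R; last first.
  by apply/funext => x; rewrite /= mulrC.
by rewrite expectationZl ?Lfun2_Lfun1// fineM// expectation_fin_num ?Lfun2_Lfun1.
Qed.

(** Centering one factor is enough, which matters for [x0], whose mean is arbitrary. *)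
Lemma dot_indep2 X Y : X \in L2 -> Y \in L2 -> indep2 Pr X Y ->
  ('E_Pr[Y] = 0)%E -> dot X Y = 0.
Proof.
move=> X2 Y2 XY Y0; rewrite /dot -[(X * Y)%R]/(X \* Y)%R.
rewrite (indep2_expectationM (Lfun2_Lfun1 X2) (Lfun2_Lfun1 Y2))//.
  by rewrite Y0 mule0.
exact: Lfun2_mul_Lfun1.
Qed.

Lemma dot_covariance X Y : X \in L2 -> Y \in L2 -> ('E_Pr[X] = 0)%E ->
  (dot X Y)%:E = covariance Pr X Y.
Proof.
move=> X2 Y2 X0.
by rewrite covarianceE ?Lfun2_mulr ?Lfun2_Lfun1// X0 mul0e sube0 dotE.
Qed.

(** Take the two-element list [[:: i; j]], with event [A] at [i] and [B] at every other index. *)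
Lemma mutually_indep_indep2 (I : eqType) (X : I -> T -> R) (i j : I) :
  mutually_indep Pr X -> i != j -> indep2 Pr (X i) (X j).
Proof.
move=> Xind ij A B mA mB.
have := Xind [:: i; j] (fun k => if k == i then A else B).
rewrite !big_cons !big_nil setIT mule1 eqxx [j == i]eq_sym (negPf ij); apply.
  by rewrite /= inE ij.
by move=> k; case: ifP.
Qed.

(** * Second moments of a linear recursion driven by white noise *)

Section linear_system.
Variables (n : nat) (Q B : 'M[R]_n) (sr2 sw2 : R).
Variables (e : nat -> 'I_n -> T -> R) (r : nat -> T -> R).
Variable w : 'I_n -> nat -> T -> R.
Hypotheses (e0_L2 : forall i, e 0 i \in L2) (r_L2 : forall t, r t \in L2).
Hypothesis w_L2 : forall i t, w i t \in L2.
Hypothesis eS : forall t i,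
  e t.+1 i = lincomb (Q i) (e t) + (lincomb (B i) (w^~ t) - r t).
Hypothesis rr : forall s t, dot (r s) (r t) = sr2 *+ (s == t).
Hypothesis ww : forall i j s t,
  dot (w i s) (w j t) = sw2 *+ ((i == j) && (s == t)).
Hypothesis wr : forall i s t, dot (w i s) (r t) = 0.
Hypothesis e0r : forall i t, dot (e 0 i) (r t) = 0.
Hypothesis e0w : forall i j t, dot (e 0 i) (w j t) = 0.

Lemma linear_system_L2 t i : e t i \in L2.
Proof.
elim: t i => [//|t IHt] i.
by rewrite eS !Lfun2D ?Lfun2N ?Lfun2_lincomb.
Qed.
Local Notation eL2 := linear_system_L2.

Lemma linear_system_dot X t i : X \in L2 ->
  dot (e t.+1 i) X = \sum_j Q i j * dot (e t j) X
    + (\sum_j B i j * dot (w j t) X - dot (r t) X).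
Proof.
move=> X2; have e2 := eL2 t.
by rewrite eS !dotDl ?Lfun2D ?Lfun2N ?Lfun2_lincomb// !dot_lincombl// dotNl.
Qed.

(** The error at time [t] involves only noises of times before [t], so [s = t] is allowed. *)
Lemma linear_system_orth_r t s i : (t <= s)%N -> dot (e t i) (r s) = 0.
Proof.
elim: t i => [//|t IHt] i ts; rewrite linear_system_dot// rr (ltn_eqF ts) subr0.
rewrite !big1 ?addr0// => j _; first by rewrite wr mulr0.
by rewrite IHt ?mulr0// ltnW.
Qed.

Lemma linear_system_orth_w t s i j : (t <= s)%N -> dot (e t i) (w j s) = 0.
Proof.
elim: t i => [//|t IHt] i ts; rewrite linear_system_dot// dotC wr subr0.
rewrite !big1 ?addr0// => k _; first by rewrite ww (ltn_eqF ts) andbF mulr0.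
by rewrite IHt ?mulr0// ltnW.
Qed.

Definition second_moment t : 'M[R]_n := \matrix_(i, j) dot (e t i) (e t j).

Lemma second_momentS t : second_moment t.+1 =
  Q *m second_moment t *m Q^T + (sw2 *: (B *m B^T) + sr2 *: const_mx 1).
Proof.
(* Of the new error, only the current noise of agent [k] correlates with [w k t]. *)
have we i k : dot (w k t) (e t.+1 i) = sw2 * B i k.
  rewrite dotC linear_system_dot// dotC wr subr0.
  rewrite big1 ?add0r => [|j _]; last by rewrite linear_system_orth_w// mulr0.
  rewrite (bigD1 k)//= big1 ?addr0 => [|j jk]; last by rewrite ww (negPf jk) mulr0.
  by rewrite ww !eqxx mulrC.
(* The innovation enters every coordinate with coefficient -1; this common shock produces the
   all-ones matrix. *)
have re i : dot (r t) (e t.+1 i) = - sr2.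
  rewrite dotC linear_system_dot// rr eqxx !big1 ?add0r// => j _.
    by rewrite wr mulr0.
  by rewrite linear_system_orth_r// mulr0.
apply/matrixP => i j; rewrite !mxE linear_system_dot ?eL2// re opprK mulr1.
rewrite !addrA; congr (_ + _ + _); last first.
  rewrite mulr_sumr; apply: eq_bigr => k _; rewrite we mxE; ring.
under [RHS]eq_bigr => k _ do rewrite !mxE mulr_suml.
(* With the sums swapped, the second factor is expanded as well; its noise terms are orthogonal to
   the error at time [t]. *)
rewrite exchange_big/=; apply: eq_bigr => k _.
rewrite dotC linear_system_dot ?eL2// [dot (r t) _]dotC.
rewrite linear_system_orth_r// subr0 [X in _ * (_ + X)]big1 => [|l _]; last first.
  by rewrite dotC linear_system_orth_w// mulr0.
rewrite addr0 mulr_sumr.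
by apply: eq_bigr => l _; rewrite mxE dotC; ring.
Qed.

End linear_system.

End second_moments.

(** * Steady state *)

(** Embeds a real root in the complex numbers, where the spectral radius condition is stated. *)
Lemma spectral_radius_lt1_real (R : rcfType) (n : nat) (Q : 'M[R]_n) (x : R) :
  spectral_radius_lt1 Q -> root (char_poly Q) x -> `|x| < 1.
Proof.
move=> Q1 Qx; have := Q1 (x%:C)%C.
rewrite -[map_poly _ _]/(map_poly (real_complex R) _) fmorph_root => /(_ Qx).
by rewrite normc_def /= expr0n addr0 sqrtr_sqr ltcR.
Qed.

(** [G] stands for the function [g] of [P]: any basis that diagonalizes [P] must diagonalize [G],
    with eigenvalues [g (d 0 i)]. This treats both schemes at once. *)
Lemma steady_state_trace (R : realType) (n : nat) (a alpha sr2 sw2 : R)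
  (P G : 'M[R]_n) (lam : 'I_n -> R) (g : R -> R) (M : nat -> 'M[R]_n) :
  let Q := a *: (P - alpha%:M) in
  P^T = P -> (forall i, \sum_j P i j = 1) ->
  char_poly P = \prod_(i < n) ('X - (lam i)%:P) ->
  spectral_radius_lt1 Q ->
  (forall (S : 'M[R]_n) (d : 'rV[R]_n), S *m P = diag_mx d *m S ->
    S *m G = diag_mx (map_mx g d) *m S) ->
  (forall t, M t.+1 = Q *m M t *m Q^T + (sw2 *: G + sr2 *: const_mx 1)) ->
  exists L : 'M[R]_n,
    (forall i j, M t i j @[t --> \oo] --> L i j) /\
    \tr L = n%:R * (sr2 / (1 - a ^+ 2 * (1 - alpha) ^+ 2)) +
      \sum_i (sw2 * g (lam i) / (1 - a ^+ 2 * (lam i - alpha) ^+ 2)).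
Proof.
move=> Q Ps P1 Plam rQ gG MS.
have [S [d [Su SP dlam]]] := sym_spectral Ps Plam.
pose q : 'rV[R]_n := \row_i (a * (d 0 i - alpha)).
have SQ : S *m Q = diag_mx q *m S.
  rewrite /Q -scalemxAr mulmxBr SP mul_mx_scalar.
  by apply/matrixP => i j; rewrite !mul_diag_mx !mxE; ring.
have q1 i : `|q 0 i| < 1.
  apply: (spectral_radius_lt1_real rQ); rewrite (char_poly_simmx Su SQ).
  rewrite char_poly_trig ?diag_mx_is_trig// (bigD1 i)//= rootM root_XsubC.
  by rewrite [diag_mx q i i]mxE eqxx mulr1n eqxx.
have Qs : Q^T = Q by rewrite /Q linearZ /= linearB /= Ps tr_scalar_mx.
have {}MS t : M t.+1 = Q *m M t *m Q + (sw2 *: G + sr2 *: const_mx 1).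
  by rewrite MS Qs.
have [L [ML trL]] := cvg_lyapunov_recurrence Su SQ q1 MS.
exists L; split=> //; rewrite trL.
pose J : 'M[R]_n := S *m const_mx 1 *m invmx S.
(* Since the rows of [P] sum to one, a nonzero [J i i] forces the eigenvalue [d 0 i] to be 1. *)
have dJ i : d 0 i * J i i = J i i.
  have : diag_mx d *m J = J.
    rewrite /J !mulmxA -SP -[S *m P *m _]mulmxA; congr (_ *m _ *m _).
    apply/matrixP => k l; rewrite !mxE -[RHS](P1 k); apply: eq_bigr => m _.
    by rewrite mxE mulr1.
  by move/matrixP/(_ i i); rewrite mul_diag_mx mxE.
have trJ : \sum_i J i i = n%:R.
  rewrite -/(\tr J) /J mxtrace_mulC mulmxA mulVmx// mul1mx /mxtrace.
  under eq_bigr do rewrite mxE.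
  by rewrite sumr_const card_ord.
pose h x := sw2 * g x / (1 - a ^+ 2 * (x - alpha) ^+ 2).
have -> : \sum_i (sw2 * g (lam i) / (1 - a ^+ 2 * (lam i - alpha) ^+ 2)) =
    \sum_i h (d 0 i).
  transitivity (\sum_(x <- [seq lam i | i <- enum 'I_n]) h x).
    by rewrite big_map big_enum.
  by rewrite -(perm_big _ dlam) big_map big_enum.
(* Writing [n%:R] as the sum of the [J i i] reduces the claim to an identity for each index. *)
rewrite -trJ mulr_suml -big_split /=; apply: eq_bigr => i _.
have -> : (S *m (sw2 *: G + sr2 *: const_mx 1) *m invmx S) i i =
    sw2 * g (d 0 i) + sr2 * J i i.
  rewrite mulmxDr mulmxDl -!scalemxAr -!scalemxAl -/J (gG _ _ SP) mulmxK//.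
  by rewrite !mxE eqxx mulr1n.
rewrite mulrDl addrC /h mxE exprMn; congr (_ + _).
have [->|J0] := eqVneq (J i i) 0; first by rewrite mulr0 !mul0r.
have -> : d 0 i = 1 by apply: (mulIf J0); rewrite dJ mul1r.
by rewrite mulrA [J i i * _]mulrC.
Qed.

Lemma sum_affine_mx (R : comNzRingType) (n : nat) (a alpha : R)
  (P : 'M[R]_n) (v : 'I_n -> R) (i : 'I_n) :
  \sum_j (a *: (P - alpha%:M)) i j * v j =
  a * (\sum_j P i j * v j - alpha * v i).
Proof.
rewrite mulrBr mulr_sumr (bigD1 i)//= [in RHS](bigD1 i)//= !mxE eqxx mulr1n.
rewrite [in LHS](eq_bigr (fun j => a * (P i j * v j))); last first.
  by move=> j ji; rewrite !mxE eq_sym (negPf ji) mulr0n subr0 mulrA.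
ring.
Qed.

Lemma stochastic_sumB (R : comNzRingType) (n : nat) (P : 'M[R]_n)
  (v : 'I_n -> R) (x : R) (i : 'I_n) : \sum_j P i j = 1 ->
  \sum_j P i j * (v j - x) = \sum_j P i j * v j - x.
Proof.
move=> P1; under eq_bigr do rewrite mulrBr.
by rewrite sumrB -mulr_suml P1 mul1r.
Qed.

(** * Error recursions of the two estimation schemes *)

Section error_recursion.
Context d (T : measurableType d) (R : realType) (N : nat).
Variables (a alpha : R) (P : 'M[R]_N) (x0 : T -> R) (r : nat -> T -> R).
Variables (w : 'I_N -> nat -> T -> R) (z0 : 'I_N -> R).
Hypothesis P1 : forall i, \sum_j P i j = 1.
Let Q := a *: (P - alpha%:M).

Lemma err_hatS t i : err_hat a alpha P x0 r w z0 t.+1 i =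
  lincomb (Q i) (err_hat a alpha P x0 r w z0 t) +
  (lincomb ((a * alpha)%:M i) (w^~ t) - r t).
Proof.
apply/funext => om; rewrite !fctE /lincomb /err_hat /= sum_affine_mx//.
rewrite stochastic_sumB//.
have -> : \sum_j (a * alpha)%:M i j * w j t om = a * alpha * w i t om.
  rewrite (bigD1 i)//= big1 ?addr0 => [|j ji].
    by rewrite mxE eqxx mulr1n.
  by rewrite mxE eq_sym (negPf ji) mul0r.
rewrite /obs; ring.
Qed.

Lemma err_tildeS t i : err_tilde a alpha P x0 r w z0 t.+1 i =
  lincomb (Q i) (err_tilde a alpha P x0 r w z0 t) +
  (lincomb (((a * alpha) *: P) i) (w^~ t) - r t).
Proof.
apply/funext => om; rewrite !fctE /lincomb /err_tilde /= sum_affine_mx//.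
rewrite stochastic_sumB//.
have -> : \sum_j ((a * alpha) *: P) i j * w j t om =
    a * alpha * \sum_j P i j * w j t om.
  by rewrite mulr_sumr; apply: eq_bigr => j _; rewrite mxE mulrA.
(* All agents observe the same state, so averaging with weights of sum one preserves it and averages
   only the noise. *)
have -> : \sum_j P i j * obs a x0 r w j t om =
    state a x0 r t om + \sum_j P i j * w j t om.
  rewrite /obs; under eq_bigr do rewrite mulrDr.
  by rewrite big_split /= -mulr_suml P1 mul1r.
ring.
Qed.

End error_recursion.

(** Common to both schemes: [B] is the gain of the observation noise, and [G] is its covariance
    shape with the factor [a ^+ 2 * alpha ^+ 2] taken out. *)
Lemma steady_state_msd (R : realType) (d : measure_display)
  (T : measurableType d) (Pr : probability T R) (N : nat)
  (a alpha sigma_r sigma_w : R) (P B G : 'M[R]_N) (lam : 'I_N -> R) (g : R -> R)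
  (x0 : T -> R) (r : nat -> T -> R) (w : 'I_N -> nat -> T -> R)
  (z0 : 'I_N -> R) (e : nat -> 'I_N -> T -> R) :
  (0 < N)%N ->
  P^T = P ->
  (forall i, \sum_(j < N) P i j = 1) ->
  char_poly P = \prod_(i < N) ('X - (lam i)%:P) ->
  x0 \in Lfun Pr 2%:E ->
  (forall t, indep2 Pr x0 (r t)) ->
  (forall i t, indep2 Pr x0 (w i t)) ->
  (forall t, r t \in Lfun Pr 2%:E) ->
  (forall t, ('E_Pr[r t] = 0)%E) ->
  (forall t, 'V_Pr[r t] = (sigma_r ^+ 2)%:E) ->
  mutually_indep Pr r ->
  (forall i t, w i t \in Lfun Pr 2%:E) ->
  (forall i t, ('E_Pr[w i t] = 0)%E) ->
  (forall i t, 'V_Pr[w i t] = (sigma_w ^+ 2)%:E) ->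
  mutually_indep Pr (fun it : 'I_N * nat => w it.1 it.2) ->
  (forall i s t, covariance Pr (w i s) (r t) = 0%E) ->
  spectral_radius_lt1 (a *: (P - alpha%:M)) ->
  (forall i om, e 0 i om = z0 i - x0 om) ->
  (forall t i, e t.+1 i = lincomb ((a *: (P - alpha%:M)) i) (e t) +
    (lincomb (B i) (w^~ t) - r t)) ->
  B *m B^T = (a ^+ 2 * alpha ^+ 2) *: G ->
  (forall (S : 'M[R]_N) (d : 'rV[R]_N), S *m P = diag_mx d *m S ->
    S *m G = diag_mx (map_mx g d) *m S) ->
  exists Sig : 'M[R]_N,
    (forall i j : 'I_N,
       ('E_Pr[(fun om => (e t i om * e t j om)%R)] @[t --> \oo]
          --> (Sig i j)%:E)%E) /\
    (N%:R)^-1 * \tr Sig =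
      sigma_r ^+ 2 / (1 - a ^+ 2 * (1 - alpha) ^+ 2) +
      (N%:R)^-1 * \sum_(i < N)
        (a ^+ 2 * alpha ^+ 2 * sigma_w ^+ 2 * g (lam i) /
           (1 - a ^+ 2 * (lam i - alpha) ^+ 2)).
Proof.
move=> N0 Ps P1 Plam x02 x0r x0w r2 r0 rV rI w2 w0 wV wI wrC rQ e0 eS BG gG.
have e0E i : e 0 i = cst (z0 i) + (- x0).
  by apply/funext => om; rewrite e0.
have e02 i : e 0 i \in Lfun Pr 2%:E.
  by rewrite e0E Lfun2D ?Lfun2N// Lfun2_cst.
have rr s t : dot Pr (r s) (r t) = sigma_r ^+ 2 *+ (s == t).
  have [->|st] := eqVneq s t.
    by apply: EFin_inj; rewrite dot_covariance// mulr1n -(rV t).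
  by apply: dot_indep2 => //; exact: mutually_indep_indep2.
have ww i j s t : dot Pr (w i s) (w j t) = sigma_w ^+ 2 *+ ((i == j) && (s == t)).
  have [/andP[/eqP-> /eqP->]|ijst] := boolP (_ && _).
    by apply: EFin_inj; rewrite dot_covariance// mulr1n -(wV j t).
  apply: dot_indep2 => //.
  by have := mutually_indep_indep2 (i := (i, s)) (j := (j, t)) wI; apply.
have wr i s t : dot Pr (w i s) (r t) = 0.
  by apply: EFin_inj; rewrite dot_covariance// wrC.
(* The initial error is a constant minus [x0]: the constant is orthogonal to [X] because [X] is
   centered, and [x0] because it is independent of [X]. *)
have e0o X : X \in Lfun Pr 2%:E -> indep2 Pr x0 X -> ('E_Pr[X] = 0)%E ->
    forall i, dot Pr (e 0 i) X = 0.
  move=> X2 x0X X0 i; rewrite e0E dotDl ?Lfun2N ?Lfun2_cst// dotNl//.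
  by rewrite dot_cstl// X0 (dot_indep2 x02)// mulr0 subr0.
have e0r i t := e0o _ (r2 t) (x0r t) (r0 t) i.
have e0w i j t := e0o _ (w2 j t) (x0w j t) (w0 j t) i.
have eL2 := linear_system_L2 e02 r2 w2 eS.
have MS t := second_momentS e02 r2 w2 eS rr ww wr e0r e0w t.
have {}MS t : second_moment Pr e t.+1 =
    (a *: (P - alpha%:M)) *m second_moment Pr e t *m (a *: (P - alpha%:M))^T +
    ((a ^+ 2 * alpha ^+ 2 * sigma_w ^+ 2) *: G + sigma_r ^+ 2 *: const_mx 1).
  by rewrite MS BG scalerA [_ * sigma_w ^+ 2]mulrC.
have [L [ML trL]] := steady_state_trace Ps P1 Plam rQ gG MS.
exists L; split=> [i j|]; last first.
  by rewrite trL mulrDr mulKf// pnatr_eq0 -lt0n.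
rewrite (_ : (fun t => _) = (fun t => (second_moment Pr e t i j)%:E)).
  by apply: cvg_EFin; [exact: nearW | exact: ML].
by apply/funext => t; rewrite mxE -dotE.
Qed.

Unset Implicit Arguments.

Theorem theorem1 (R : realType) (d : measure_display) (T : measurableType d)
  (Pr : probability T R) (N : nat) (a alpha sigma_r sigma_w : R)
  (P : 'M[R]_N) (lam : 'I_N -> R)
  (x0 : T -> R) (r : nat -> T -> R) (w : 'I_N -> nat -> T -> R)
  (xh0 xt0 : 'I_N -> R) :
  (2 <= N)%N ->
  0 < alpha <= 1 ->
  (* P symmetric, nonnegative, doubly stochastic *)
  P^T = P ->
  (forall i j, 0 <= P i j) ->
  (forall i, \sum_(j < N) P i j = 1) ->
  (forall j, \sum_(i < N) P i j = 1) ->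
  (* lam lists the eigenvalues of P (with multiplicity), in decreasing order:
     lam i = lambda_{i+1}(P) *)
  char_poly P = \prod_(i < N) ('X - (lam i)%:P) ->
  (forall i j : 'I_N, (i <= j)%N -> lam j <= lam i) ->
  (forall i : 'I_N, nat_of_ord i = 0%N -> lam i = 1) ->
  (forall i : 'I_N, nat_of_ord i = 1%N -> lam i < 1) ->
  (forall i : 'I_N, nat_of_ord i = N.-1 -> -1 < lam i) ->
  (* x_0: finite (second-order) random variable, independent of the noises *)
  x0 \in Lfun Pr 2%:E ->
  (forall t, indep2 Pr x0 (r t)) ->
  (forall i t, indep2 Pr x0 (w i t)) ->
  (* innovations: zero mean, variance sigma_r^2, independent over time *)
  (forall t, r t \in Lfun Pr 2%:E) ->
  (forall t, ('E_Pr[r t] = 0)%E) ->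
  (forall t, 'V_Pr[r t] = (sigma_r ^+ 2)%:E) ->
  mutually_indep Pr r ->
  (* observation noises: zero mean, variance sigma_w^2,
     independent over time and across agents *)
  (forall i t, w i t \in Lfun Pr 2%:E) ->
  (forall i t, ('E_Pr[w i t] = 0)%E) ->
  (forall i t, 'V_Pr[w i t] = (sigma_w ^+ 2)%:E) ->
  mutually_indep Pr (fun it : 'I_N * nat => w it.1 it.2) ->
  (* observation noises uncorrelated with the innovations *)
  (forall i s t, covariance Pr (w i s) (r t) = 0%E) ->
  (* rho(Q) < 1 for Q = a (P - alpha I) *)
  spectral_radius_lt1 (a *: (P - alpha%:M)) ->
  let R_MSD := sigma_r ^+ 2 / (1 - a ^+ 2 * (1 - alpha) ^+ 2) in
  (exists Sig_hat : 'M[R]_N,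
     (forall i j : 'I_N,
        ('E_Pr[(fun om => (err_hat a alpha P x0 r w xh0 t i om
                          * err_hat a alpha P x0 r w xh0 t j om)%R)]
           @[t --> \oo] --> (Sig_hat i j)%:E)%E) /\
     (N%:R)^-1 * \tr Sig_hat =
       R_MSD + (N%:R)^-1 * \sum_(i < N)
         (a ^+ 2 * alpha ^+ 2 * sigma_w ^+ 2 /
            (1 - a ^+ 2 * (lam i - alpha) ^+ 2))) /\
  (exists Sig_tilde : 'M[R]_N,
     (forall i j : 'I_N,
        ('E_Pr[(fun om => (err_tilde a alpha P x0 r w xt0 t i om
                          * err_tilde a alpha P x0 r w xt0 t j om)%R)]
           @[t --> \oo] --> (Sig_tilde i j)%:E)%E) /\
     (N%:R)^-1 * \tr Sig_tilde =
       R_MSD + (N%:R)^-1 * \sum_(i < N)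
         (a ^+ 2 * alpha ^+ 2 * sigma_w ^+ 2 * lam i ^+ 2 /
            (1 - a ^+ 2 * (lam i - alpha) ^+ 2))).
Proof.
move=> N2 alpha01 Ps P0 P1 P1' Plam lamd lam1 lam2 lamN x02 x0r x0w r2 r0 rV rI.
move=> w2 w0 wV wI wrC rQ R_MSD; split.
  (* Raw observations: the gain is scalar, [G] is the identity and [g] is constantly 1. *)
  have /= := @steady_state_msd R d T Pr N a alpha sigma_r sigma_w P (a * alpha)%:M
    1%:M lam (fun=> 1) x0 r w xh0 (err_hat a alpha P x0 r w xh0)
    (ltnW N2) Ps P1 Plam x02 x0r x0w r2 r0 rV rI w2 w0 wV wI wrC rQ.
  under eq_bigr do rewrite mulr1.
  apply=> //.
  - by move=> t i; rewrite err_hatS.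
  - by rewrite tr_scalar_mx -scalar_mxM scale_scalar_mx mulr1 -expr2 exprMn.
  - move=> S e _; rewrite mulmx1 (_ : map_mx _ _ = const_mx 1).
      by rewrite diag_const_mx mul1mx.
    by apply/matrixP => i j; rewrite !mxE.
(* Averaged observations: the gain is proportional to [P], so [G] is [P *m P] and [g] is
   squaring. *)
apply: (@steady_state_msd R d T Pr N a alpha sigma_r sigma_w P ((a * alpha) *: P)
  (P *m P) lam (fun x => x ^+ 2) x0 r w xt0) => //.
- exact: ltnW.
- by move=> t i; rewrite err_tildeS.
- by rewrite linearZ /= Ps -scalemxAl -scalemxAr scalerA -expr2 exprMn.
- move=> S e SP; rewrite mulmxA SP -mulmxA SP mulmxA mulmx_diag.
  by congr (diag_mx _ *m _); apply/matrixP => i j; rewrite !mxE ord1 expr2.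
Qed.
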